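(* Let $N=\{1,\dots,n\}$ be a set of $n\ge1$ agents and $M$ a finite set of indivisible goods. There exists a deterministic truthful mechanism $\mathcal{X}$, defined on all profiles $\boldsymbol v=(v_1,\dots,v_n)$ of normalized, monotone, subadditive leveled valuations on $M$, such that for every such profile the allocation $\mathcal{X}(\boldsymbol v)$ is simultaneously EFX and $\frac12$-MMS.
   Context: A valuation $v:2^M\to\mathbb{R}_{\ge0}$ is normalized if $v(\emptyset)=0$, monotone if $v(S)\le v(T)$ whenever $S\subseteq T$, subadditive if $v(S)+v(T)\ge v(S\cup T)$ for all $S,T\subseteq M$, and leveled if $v(S)>v(T)$ whenever $|S|>|T|$. $\Pi_n(M)$ is the set of all tuples $(A_1,\dots,A_n)$ of pairwise disjoint (possibly empty) subsets of $M$ whose union is $M$ (allocations). A deterministic mechanism (without payments) is a map $\mathcal{X}$ from valuation profiles in the given domain to $\Pi_n(M)$; $\mathcal{X}_i(\boldsymbol v)$ is agent $i$'s bundle. It is truthful if $v_i(\mathcal{X}_i(\boldsymbol v))\ge v_i(\mathcal{X}_i(v_i',v_{-i}))$ for every profile $\boldsymbol v$, agent $i$, and valuation $v_i'$ in the domain. An allocation $A$ is EFX if $v_i(A_i)\ge v_i(A_j\setminus\{g\})$ for all $i,j\in N$, $g\in A_j$. It is $\alpha$-MMS if $v_i(A_i)\ge\alpha\,\mu_i^n(M)$ for all $i$, where $\mu_i^n(M)=\max_{A\in\Pi_n(M)}\min_{l\in\{1,\dots,n\}}v_i(A_l)$. *)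

(* Defs.v *)
From mathcomp Require Import all_boot all_order all_algebra reals.

Set Implicit Arguments.
Unset Strict Implicit.
Unset Printing Implicit Defensive.

Import Order.TTheory GRing.Theory Num.Theory.
Local Open Scope ring_scope.

Record valuation (R : realType) (M : finType) := Valuation {
  value :> {set M} -> R;
  value_ge0 : forall S : {set M}, 0 <= value S
}.

Section ValuationProperties.
Context {R : realType} {M : finType}.
Implicit Types (v : valuation R M).

Definition normalized v : Prop := v set0 = 0.

Definition monotone v : Prop :=
  forall S T : {set M}, S \subset T -> v S <= v T.

Definition subadditive v : Prop :=
  forall S T : {set M}, v (S :|: T) <= v S + v T.

Definition leveled v : Prop :=
  forall S T : {set M}, (#|T| < #|S|)%N -> v T < v S.

Definition subadditive_leveled v : Prop :=
  [/\ normalized v, monotone v, subadditive v & leveled v].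

End ValuationProperties.

Definition is_allocation (M : finType) (n : nat)
    (A : {ffun 'I_n -> {set M}}) : bool :=
  [forall i, forall j, (i != j) ==> [disjoint A i & A j]]
    && (\bigcup_(i < n) A i == [set: M]).

Definition allocation (M : finType) (n : nat) : Type :=
  {A : {ffun 'I_n -> {set M}} | is_allocation A}.

Definition bundle (M : finType) (n : nat) (A : allocation M n) (i : 'I_n) :
  {set M} := val A i.

Section Fairness.
Context {R : realType} {M : finType} {n : nat}.

Definition EFX (v : 'I_n -> valuation R M) (A : allocation M n) : Prop :=
  forall (i j : 'I_n) (g : M), g \in bundle A j ->
    v i (bundle A j :\ g) <= v i (bundle A i).

(* The index l0 only witnesses 0 < n: seeding the iterated minimum with the   *)
(* term at l0 makes it the true minimum over all bundles, whatever l0 is.     *)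
(* The seed 0 of the maximum is harmless because valuations are nonnegative   *)
(* and, as 0 < n, allocations exist.                                          *)
Definition mms_share (l0 : 'I_n) (v : valuation R M) : R :=
  \big[Num.max/0]_(A : allocation M n)
    \big[Num.min/v (bundle A l0)]_(l < n) v (bundle A l).

Definition MMS (alpha : R) (v : 'I_n -> valuation R M) (A : allocation M n) :
  Prop := forall i : 'I_n, alpha * mms_share i (v i) <= v i (bundle A i).

End Fairness.

Section Mechanisms.
Context {R : realType} {M : finType} {n : nat}.
Variable D : valuation R M -> Prop.

Definition profile : Type := 'I_n -> {v : valuation R M | D v}.

Definition valuations (v : profile) (i : 'I_n) : valuation R M := sval (v i).

Definition mechanism : Type := profile -> allocation M n.

Definition deviate (v : profile) (i : 'I_n) (w : {v : valuation R M | D v}) :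
  profile := fun j => if j == i then w else v j.

Definition truthful (X : mechanism) : Prop :=
  forall (v : profile) (i : 'I_n) (w : {v : valuation R M | D v}),
    valuations v i (bundle (X (deviate v i w)) i)
      <= valuations v i (bundle (X v) i).

End Mechanisms.

Arguments profile {R M} n D.
Arguments mechanism {R M} n D.

(* Main.v *)
(** Serial dictatorship with fixed quotas. Write m = q n + r for the number of
    goods, r < n. Agents choose in turn a favourite set of remaining goods; the
    first n - r agents take q goods each, the last r agents take q + 1.
    Truthfulness holds because an agent's report affects neither what remains
    at her turn nor her quota. For EFX, levels leave only the case where an
    agent with q goods compares with a later agent with q + 1 goods, and then
    the reduced bundle was available to her. For MMS, some bundle of any
    allocation has at most q goods; if it has exactly q >= 2 goods, split it in
    two smaller sets, each worth less than any q-set, and use subadditivity.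
    If q = 1, counting gives a bundle with at most one good, none of them taken
    before the turn of the agent. *)
Require Import Defs.
From mathcomp Require Import all_boot all_order all_algebra reals.
From mathcomp Require Import zify lra.

Import Order.TTheory GRing.Theory Num.Theory.
Local Open Scope ring_scope.

(** * Successive favourite choices under arbitrary quotas *)

Section SerialDictatorship.
Context {R : realType} {M : finType}.
Implicit Types (u : {set M} -> R) (S T : {set M}) (pref : nat -> {set M} -> R).

(** The first [k] elements of [S] only seed the maximum: they form an admissible set as soon as
    [k <= #|S|]. *)
Definition favourite u S k : {set M} :=
  [arg max_(T > [set x in take k (enum S)] | (T \subset S) && (#|T| == k)) u T]%O.

Lemma favouriteP u S k : (k <= #|S|)%N ->
  [/\ favourite u S k \subset S, #|favourite u S k| = k &
      forall T, T \subset S -> #|T| = k -> u T <= u (favourite u S k)].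
Proof.
move=> leks; rewrite /favourite; case: arg_maxP => [|T /andP[sTS /eqP cT] Tmax].
  apply/andP; split.
    by apply/subsetP=> x; rewrite inE => /mem_take; rewrite mem_enum.
  by rewrite cardsE (card_uniqP _) ?take_uniq ?enum_uniq // size_takel -?cardE.
by split=> // T' sT' cT'; apply: Tmax; rewrite sT' cT' eqxx.
Qed.

Fixpoint taken (quota : nat -> nat) pref k : {set M} :=
  if k is k'.+1 then
    let S := taken quota pref k' in S :|: favourite (pref k') (~: S) (quota k')
  else set0.

Definition choice_at quota pref k : {set M} :=
  favourite (pref k) (~: taken quota pref k) (quota k).

(** The source of truthfulness: a deviation at turn [k] changes [pref] at [k] only, so the goods on
    offer at that turn stay the same. *)
Lemma eq_taken quota pref pref' k :
  (forall j, (j < k)%N -> pref j = pref' j) ->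
  taken quota pref k = taken quota pref' k.
Proof.
elim: k => //= k IHk eqp.
by rewrite eqp // IHk // => j ltjk; apply: eqp; rewrite ltnS ltnW.
Qed.

Lemma taken_bigcup quota pref k :
  taken quota pref k = \bigcup_(i < k) choice_at quota pref i.
Proof. by elim: k => [|k IHk]; rewrite ?big_ord0 // big_ord_recr /= -IHk. Qed.

Lemma subset_taken quota pref j k :
  (j <= k)%N -> taken quota pref j \subset taken quota pref k.
Proof.
elim: k => [|k IHk]; first by rewrite leqn0 => /eqP->.
rewrite leq_eqVlt => /predU1P[-> //|]; rewrite ltnS => /IHk sjk.
exact: subset_trans sjk (subsetUl _ _).
Qed.

Section Feasible.
Variables (quota : nat -> nat) (pref : nat -> {set M} -> R) (n : nat).
Hypothesis feasible : (\sum_(i < n) quota i <= #|M|)%N.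

Lemma quota_le_left k : (k < n)%N ->
  #|taken quota pref k| = (\sum_(i < k) quota i)%N ->
  (quota k <= #|~: taken quota pref k|)%N.
Proof.
move=> ltkn ck; rewrite -(leq_add2l #|taken quota pref k|) cardsC ck.
rewrite -(big_ord_recr k (fun i : 'I_k.+1 => quota i)) (leq_trans _ feasible) //.
rewrite -!(big_mkord xpredT quota) [leqRHS](big_cat_nat (n := k.+1)) //.
exact: leq_addr.
Qed.

Lemma card_taken k :
  (k <= n)%N -> #|taken quota pref k| = (\sum_(i < k) quota i)%N.
Proof.
elim: k => [|k IHk] lekn; first by rewrite cards0 big_ord0.
have ck := IHk (ltnW lekn).
have [sS cS _] := favouriteP (pref k) _ _ (quota_le_left _ lekn ck).
rewrite big_ord_recr /= cardsU ck cS.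
suff -> : taken quota pref k :&: choice_at quota pref k = set0.
  by rewrite cards0 subn0.
by apply/eqP; rewrite setI_eq0 disjoint_sym disjoints_subset.
Qed.

Lemma choice_atP k : (k < n)%N ->
  [/\ choice_at quota pref k \subset ~: taken quota pref k,
      #|choice_at quota pref k| = quota k &
      forall T, T \subset ~: taken quota pref k -> #|T| = quota k ->
        pref k T <= pref k (choice_at quota pref k)].
Proof.
by move=> ltkn; apply/favouriteP/quota_le_left => //; apply/card_taken/ltnW.
Qed.

Lemma disjoint_choice_at i j : (i < j < n)%N ->
  [disjoint choice_at quota pref i & choice_at quota pref j].
Proof.
move=> /andP[ltij ltjn]; have [sj _ _] := choice_atP _ ltjn.
rewrite disjoint_sym disjoints_subset (subset_trans sj) // setCS.
exact: subset_trans (subsetUr _ _) (subset_taken _ _ _ _ ltij).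
Qed.

Lemma choice_at_allocation : (\sum_(i < n) quota i)%N = #|M| ->
  is_allocation [ffun i : 'I_n => choice_at quota pref i].
Proof.
move=> sumq; apply/andP; split.
  apply/forallP=> i; apply/forallP=> j; apply/implyP=> neij; rewrite !ffunE.
  have [ltij|ltji|eqij] := ltngtP i j.
  - by apply: disjoint_choice_at; rewrite ltij ltn_ord.
  - by rewrite disjoint_sym; apply: disjoint_choice_at; rewrite ltji ltn_ord.
  - by rewrite (val_inj eqij) eqxx in neij.
under eq_bigr do rewrite ffunE.
(* Coverage is a count: the union has as many elements as the quotas sum to, that is [#|M|]. *)
by rewrite -taken_bigcup eqEcard subsetT cardsT card_taken ?sumq /=.
Qed.

End Feasible.
End SerialDictatorship.

(** * Balanced quotas, the larger ones last *)

Definition quota (m n i : nat) : nat := m %/ n + (n - m %% n <= i)%N.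

(** The truncated difference counts the larger quotas among the first [k]; it vanishes while only
    smaller ones have occurred. *)
Lemma sum_quota_lt m n k :
  (\sum_(i < k) quota m n i)%N = (k * (m %/ n) + (k - (n - m %% n)))%N.
Proof.
elim: k => [|k IHk]; first by rewrite big_ord0.
by rewrite big_ord_recr /= IHk /quota mulSn; lia.
Qed.

Lemma sum_quota m n : (0 < n)%N -> (\sum_(i < n) quota m n i)%N = m.
Proof.
move=> n0; rewrite sum_quota_lt [RHS](divn_eq m n) mulnC.
by have := ltn_pmod m n0; lia.
Qed.

(** * Upper bounds on the maximin share *)

Section Shares.
Context {R : realType} {M : finType} {n : nat}.
Implicit Types (v : valuation R M) (A : allocation M n) (S T : {set M}).

Lemma mms_share_le (l0 : 'I_n) v c : 0 <= c ->
  (forall A, exists l, v (bundle A l) <= c) -> mms_share l0 v <= c.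
Proof.
move=> c0 small; apply: bigmax_le => // A _; have [l vl] := small A.
by apply: le_trans vl; apply: (bigmin_le _ l (fun l => v (bundle A l))).
Qed.

(** Double counting: each good lies in exactly one bundle. *)
Lemma sum_card_bundleI A T : (\sum_(l < n) #|bundle A l :&: T|)%N = #|T|.
Proof.
case: A => A /= allocA; rewrite /bundle /=; case/andP: allocA => disj /eqP covA.
have part x : (\sum_(l < n) (x \in A l))%N = 1%N.
  have /bigcupP[l _ xl] : x \in \bigcup_(i < n) A i by rewrite covA inE.
  rewrite (bigD1 l) //= xl big1 // => j nejl.
  have := implyP (forallP (forallP disj j) l) nejl.
  by move/disjointFl => /(_ _ xl) ->.
under eq_bigr do rewrite -sum1_card big_mkcond /=.
rewrite exchange_big -sum1_card [RHS]big_mkcond /=; apply: eq_bigr => x _.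
under eq_bigr do rewrite inE.
case: (x \in T); last by rewrite big1 // => l _; rewrite andbF.
by rewrite -[RHS](part x); apply: eq_bigr => l _; rewrite andbT; case: (x \in A l).
Qed.

(** Pigeonhole with the goods of [T] counted twice. For [T = set0] this is plain averaging; for
    [c = 2] the bundle found has at most one good, and none from [T]. *)
Lemma small_bundle A T c : (#|M| + #|T| < n * c)%N ->
  exists l, (#|bundle A l| + #|bundle A l :&: T| < c)%N.
Proof.
move=> lt_c; apply/existsP; apply: contraLR lt_c; rewrite negb_exists -leqNgt.
move=> /forallP big; rewrite -cardsT -(sum_card_bundleI A setT).
rewrite -(sum_card_bundleI A T) -big_split /= -[n in (n * c)%N]card_ord -sum_nat_const.
by apply: leq_sum => l _; rewrite setIT leqNgt big.
Qed.

(** At equal sizes, [T] splits into a singleton and the rest; both are smaller than [S], the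
    singleton because [1 < #|S|]. *)
Lemma level_le_double v S T : subadditive v -> leveled v ->
  (#|T| <= #|S|)%N -> (1 < #|S|)%N -> v T <= 2 * v S.
Proof.
move=> sub lev leTS S1; have S0 : 0 <= v S := value_ge0 v S.
have [ltTS|geTS] := ltnP #|T| #|S|; first by have := lev _ _ ltTS; lra.
have /card_gt0P[x xT] : (0 < #|T|)%N by lia.
have := cardsD1 x T; rewrite xT => cT.
have := sub [set x] (T :\ x); rewrite setD1K //.
have := lev S [set x]; rewrite cards1 => /(_ S1).
have : v (T :\ x) < v S by apply: lev; lia.
lra.
Qed.

End Shares.

(** * The mechanism and its guarantees *)

Section QuotaMechanism.
Context {R : realType} {M : finType} {n : nat}.
Notation domain := (@subadditive_leveled R M).
Notation quotas := (quota #|M| n.+1).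

(** Turns are plain naturals for the recursion of [taken]; values of [inord] beyond the last agent
    are never consulted. *)
Definition preferences (v : profile n.+1 domain) (k : nat) : {set M} -> R :=
  valuations v (inord k).

Lemma quota_feasible : (\sum_(i < n.+1) quotas i <= #|M|)%N.
Proof. by rewrite sum_quota. Qed.

Definition quota_mechanism : mechanism n.+1 domain := fun v =>
  Sub _ (choice_at_allocation quotas (preferences v) n.+1 quota_feasible
           (sum_quota #|M| n.+1 isT)).

Lemma bundle_quota_mechanism v i :
  bundle (quota_mechanism v) i = choice_at quotas (preferences v) i.
Proof. by rewrite /bundle SubK ffunE. Qed.

Lemma quota_mechanismP v (i : 'I_n.+1) :
  [/\ bundle (quota_mechanism v) i \subset ~: taken quotas (preferences v) i,
      #|bundle (quota_mechanism v) i| = quotas i &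
      forall T : {set M}, T \subset ~: taken quotas (preferences v) i -> #|T| = quotas i ->
        valuations v i T <= valuations v i (bundle (quota_mechanism v) i)].
Proof.
rewrite bundle_quota_mechanism.
have := choice_atP quotas (preferences v) n.+1 quota_feasible i (ltn_ord i).
by have -> : preferences v i = valuations v i by rewrite /preferences inord_val.
Qed.

Lemma quota_mechanism_truthful : truthful quota_mechanism.
Proof.
move=> v i w; have [_ _ best] := quota_mechanismP v i.
have [sub card _] := quota_mechanismP (deviate v i w) i.
apply: best => //; rewrite (eq_taken _ _ (preferences (deviate v i w))) // => j ltji.
rewrite /preferences /valuations /deviate -val_eqE /= inordK ?ltn_eqF //.
exact: ltn_trans ltji (ltn_ord i).
Qed.

Lemma quota_mechanism_EFX v : EFX (valuations v) (quota_mechanism v).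
Proof.
move=> i j g gj; have [_ _ _ lev] := svalP (v i).
have [_ ci best] := quota_mechanismP v i; have [sj cj _] := quota_mechanismP v j.
have := cardsD1 g (bundle (quota_mechanism v) j); rewrite gj cj => cjg.
have [/lev/ltW //|le_ij] := ltnP #|bundle (quota_mechanism v) j :\ g|
  #|bundle (quota_mechanism v) i|.
(* Quotas differ by at most one and never decrease, so a strictly larger quota for [j] places [i]
   earlier. *)
rewrite ci in le_ij; have ltij : (i <= j)%N by rewrite /quota in cjg le_ij; lia.
apply: best; last by rewrite /quota in cjg le_ij *; lia.
apply: subset_trans (subsetDl _ _) (subset_trans sj _).
by rewrite setCS subset_taken.
Qed.

Lemma quota_mechanism_half_MMS v :
  MMS (1 / 2) (valuations v) (quota_mechanism v).
Proof.
move=> i; have [norm _ sub lev] := svalP (v i).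
have [_ ci best] := quota_mechanismP v i.
have := value_ge0 (valuations v i) (bundle (quota_mechanism v) i).
set u := valuations v i in best *; set B := bundle _ i in ci best * => B0.
suff : mms_share i u <= 2 * u B by lra.
apply: mms_share_le => [|A]; first by lra.
have q_m := divn_eq #|M| n.+1; have lt_r := ltn_pmod #|M| (ltn0Sn n).
have [i_last|i_first] := leqP (n.+1 - #|M| %% n.+1)%N i.
  (* Not all bundles can have more than [#|M| %/ n.+1] goods, while this agent does. *)
  have [|l] := small_bundle A set0 (#|M| %/ n.+1).+1; first by rewrite cards0; nia.
  rewrite setI0 cards0 addn0 => cl; exists l.
  have /lev/ltW : (#|bundle A l| < #|B|)%N by rewrite ci /quota i_last addn1.
  by rewrite -[sval _]/u; lra.
have qi : quotas i = (#|M| %/ n.+1)%N by rewrite /quota leqNgt i_first addn0.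
have [q_gt1|q_lt1|q_eq1] := ltngtP 1%N (#|M| %/ n.+1)%N.
- have [|l] := small_bundle A set0 (#|M| %/ n.+1).+1; first by rewrite cards0; nia.
  rewrite setI0 cards0 addn0 ltnS => cl; exists l.
  by apply: level_le_double; rewrite // ci qi.
(* The quotient is 0: with fewer goods than agents, some bundle is empty. *)
- have [|l] := small_bundle A set0 1; first by rewrite cards0; nia.
  rewrite setI0 cards0 addn0 ltnS leqn0 cards_eq0 => /eqP cl; exists l.
  by rewrite cl -[u set0]/(sval (v i) set0) norm; lra.
set T := taken quotas (preferences v) i in best.
have cT : #|T| = i.
  rewrite (card_taken _ _ n.+1 quota_feasible) ?(ltnW (ltn_ord i)) //.
  by rewrite sum_quota_lt -q_eq1; lia.
(* Here [#|M| = n.+1 + r] and [i < n.+1 - r], whence [#|M| + i < n.+1 * 2]. *)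
have [|l cl] := small_bundle A T 2; first by rewrite cT; lia.
exists l; suff : u (bundle A l) <= u B by lra.
(* The bundle is empty or a single good still on offer, so the choice beats it even without the
   factor 2. *)
have [l0|l_gt0] := posnP #|bundle A l|.
  by rewrite (cards0_eq l0) -[u set0]/(sval (v i) set0) norm.
apply: best; last by rewrite qi -q_eq1; lia.
by rewrite -disjoints_subset -setI_eq0 -cards_eq0; lia.
Qed.

End QuotaMechanism.

Theorem corollary5 (R : realType) (M : finType) (n : nat) (hn : (0 < n)%N) :
  exists X : mechanism n (@subadditive_leveled R M),
    truthful X /\
    forall v : profile n (@subadditive_leveled R M),
      EFX (valuations v) (X v) /\ MMS (1 / 2) (valuations v) (X v).
Proof.
case: n hn => // n _; exists quota_mechanism.
split; first exact: quota_mechanism_truthful.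
move=> v; split; first exact: quota_mechanism_EFX.
exact: quota_mechanism_half_MMS.
Qed.
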